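(* Let $G$ be a connected graph and let $k$ and $\lambda$ be positive integers with $k\ge 2$. If $\lambda\ge \frac{t_{k+1}}{k+1}$, then $t_k\ge t_{k+1}-\lambda+1$.
   Context: All graphs are finite, undirected, without loops or multiple edges. The order of a (sub)graph is its number of vertices. A leaf of a tree is a vertex of degree one in the tree. For a positive integer $k$, a $k$-ended tree is a tree with at most $k$ leaves. For a graph $G$ and an integer $k\ge 2$, $t_k$ denotes the order of a largest $k$-ended tree that is a (not necessarily induced) subgraph of $G$; in particular $t_2$ is the order of a longest path. *)

(* Defs.v *)
From mathcomp Require Import all_boot.

Set Implicit Arguments.
Unset Strict Implicit.
Unset Printing Implicit Defensive.

Record sgraph := SGraph {
  vertex :> finType;
  adj : rel vertex;
  adj_sym : symmetric adj;
  adj_irrefl : irreflexive adj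
}.

Definition edges (G : sgraph) : {set {set G}} :=
  [set A | [exists x, exists y, adj x y && (A == [set x; y])]].

Definition connected_on (T : finType) (V : {set T}) (r : rel T) : bool :=
  (V != set0) && [forall x in V, forall y in V, connect r x y].

Definition connected_graph (G : sgraph) : bool := connected_on [set: G] (@adj G).

(* A candidate subgraph is a pair (vertex set, edge set); [is_subgraph] says   *)
(* that the edges are edges of G with both ends in the vertex set.             *)
Definition subgr (G : sgraph) : finType := ({set G} * {set {set G}})%type.

Definition sub_order (G : sgraph) (H : subgr G) : nat := #|H.1|.

Definition is_subgraph (G : sgraph) (H : subgr G) : bool :=
  (H.2 \subset edges G) && [forall A in H.2, A \subset H.1].

Definition sub_adj (G : sgraph) (H : subgr G) : rel G :=
  fun x y => [set x; y] \in H.2.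

Definition sub_degree (G : sgraph) (H : subgr G) (x : G) : nat :=
  #|[set y | sub_adj H x y]|.

(* Cycles have pairwise distinct vertices, so bounding their length by #|T|    *)
(* only serves to make the predicate boolean: see [acyclicP].                  *)
Definition acyclic (T : finType) (r : rel T) : bool :=
  [forall n : 'I_#|T|.+1, forall c : n.-tuple T, (2 < n) ==> ~~ ucycleb r c].

Lemma acyclicP (T : finType) (r : rel T) :
  reflect (forall c : seq T, 2 < size c -> ~ ucycle r c) (acyclic r).
Proof.
apply: (iffP forallP) => [acr c c_gt2 ucc | acr n].
  have c_le : size c < #|T|.+1.
    by case/andP: ucc => _ uc; rewrite ltnS -(card_uniqP uc) max_card.
  have /forallP/(_ (in_tuple c)) := acr (Ordinal c_le).
  by rewrite /= c_gt2 /=; apply/negP; rewrite negbK.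
apply/forallP => c; apply/implyP => n_gt2; apply/negP => ucc.
by apply: (acr c) => //; rewrite size_tuple.
Qed.

Definition is_tree (G : sgraph) (H : subgr G) : bool :=
  [&& is_subgraph H, connected_on H.1 (sub_adj H) & acyclic (sub_adj H)].

Definition leaves (G : sgraph) (H : subgr G) : {set G} :=
  [set x in H.1 | sub_degree H x == 1].

Definition ended_tree (G : sgraph) (k : nat) (H : subgr G) : bool :=
  is_tree H && (#|leaves H| <= k).

Definition tk (G : sgraph) (k : nat) : nat :=
  \max_(H : subgr G | ended_tree k H) sub_order H.

(* Main.v *)
Require Import Defs.
From mathcomp Require Import all_boot all_order all_algebra.

Set Implicit Arguments.
Unset Strict Implicit.
Unset Printing Implicit Defensive.


(** A largest [k.+1]-ended tree [H] may be assumed to have exactly [k.+1 >= 3]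
    leaves, since otherwise it is itself a [k]-ended tree.  The classical
    argument removes from [H] the branch that leads from a leaf [x] to the
    nearest vertex of degree at least three: this destroys one leaf and creates
    none.  The [k.+1] branches are disjoint and miss the vertices of degree at
    least three, so together they have fewer than [tk G k.+1 <= lam * k.+1]
    vertices, and one of them has fewer than [lam] vertices.

    Following a branch vertex by vertex is avoided: the part of [H] left after
    pruning [x] is taken to be a smallest connected set [S x] of vertices of
    [H] that contains all leaves except [x].
    - The leaves of the tree induced on [S x] are among the other leaves of
      [H], because any further one could be deleted from [S x]
      ([smallest_connected_in]).
    - The complements of the [S x] are pairwise disjoint: for [x != z] the sets
      [S x] and [S z] share a third leaf, so their union is connected; it
      contains all leaves, and in a tree such a set is everything
      ([connected_in_ends_full], [prunings_cover]).
    - The complements do not cover [H]: otherwise some edge [w u] leads from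
      inside some [S x] to outside it, and its end [w] lies outside some [S z];
      then [S x] contains [w] only, [S z] contains [u] only, and yet they share
      a third leaf, which puts the edge on a cycle ([edge_separates],
      [prunings_common]). *)

(** * Connected vertex sets of a relation *)

Section ConnectedSets.

Variables (T : finType) (r : rel T).
Implicit Types (A B D S U V : {set T}) (u v w x y z : T).

Definition induced U : rel T := fun x y => [&& x \in U, y \in U & r x y].

Definition connected_in U : bool := connected_on U (induced U).

Definition ends U : {set T} :=
  [set x in U | #|[set y | induced U x y]| == 1].

Lemma connect_crossing (e : rel T) A x y :
  connect e x y -> x \in A -> y \notin A ->
  exists u w, [/\ u \in A, w \notin A & e u w].
Proof.
case/connectP=> p + ->; elim: p x => [|z p IHp] x /=; first by move=> _ ->.
case/andP=> exz ezp Ax yA; case: (boolP (z \in A)) => [Az|zA].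
  exact: IHp ezp Az yA.
by exists x, z.
Qed.

Lemma connect_inducedS A B x y :
  A \subset B -> connect (induced A) x y -> connect (induced B) x y.
Proof.
move=> sAB; apply: connect_sub => u w /and3P[Au Aw ruw].
by apply: connect1; rewrite /induced !(subsetP sAB) ?ruw.
Qed.

Lemma connected_in_connect U x y :
  connected_in U -> x \in U -> y \in U -> connect (induced U) x y.
Proof.
by case/andP=> _ /forall_inP cU Ux Uy; move/forall_inP: (cU x Ux); apply.
Qed.

Hypothesis r_sym : symmetric r.

Lemma induced_sym U : symmetric (induced U).
Proof. by move=> x y; rewrite /induced r_sym andbCA. Qed.

Lemma connected_in_hub U z :
  z \in U -> {in U, forall x, connect (induced U) z x} -> connected_in U.
Proof.
move=> Uz cz; apply/andP; split; first by apply/set0Pn; exists z.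
apply/forall_inP => x Ux; apply/forall_inP => y Uy.
apply: connect_trans (cz y Uy).
by rewrite (sym_connect_sym (induced_sym U)) cz.
Qed.

Lemma connected_inU A B z :
  connected_in A -> connected_in B -> z \in A -> z \in B ->
  connected_in (A :|: B).
Proof.
move=> cA cB Az Bz; apply: (@connected_in_hub _ z) => [|x].
  by rewrite inE Az.
case/setUP=> [Ax|Bx].
  by apply: connect_inducedS (subsetUl A B) _; apply: connected_in_connect.
by apply: connect_inducedS (subsetUr A B) _; apply: connected_in_connect.
Qed.

Lemma connected_in_add A u w :
  connected_in A -> u \in A -> r u w -> connected_in (w |: A).
Proof.
move=> cA Au ruw; apply: (@connected_in_hub _ u) => [|x].
  by rewrite !inE Au orbT.
case/setU1P=> [->|Ax].
  by apply: connect1; rewrite /induced !inE eqxx Au orbT.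
by apply: connect_inducedS (subsetUr _ A) _; apply: connected_in_connect.
Qed.

Hypothesis r_irrefl : irreflexive r.

(** Sending [v] to its only neighbour and fixing the other vertices turns each
    walk in [U] into a walk that avoids [v]. *)
Lemma connected_in_del_pendant U v :
  connected_in U -> v \in ends U -> connected_in (U :\ v).
Proof.
move=> cU; rewrite inE => /andP[Uv /cards1P[w Nv]].
have /and3P[_ Uw rvw] : induced U v w by have := set11 w; rewrite -Nv inE.
have only_w t : induced U v t -> t = w.
  by move=> evt; apply/set1P; rewrite -Nv inE.
have wv : w != v by apply: contraTneq rvw => ->; rewrite r_irrefl.
have Dw : w \in U :\ v by rewrite !inE wv.
apply: (connected_in_hub Dw) => x /setD1P[xv Ux].
pose f y := if y == v then w else y.
suff fwalk y z :
    connect (induced U) y z -> connect (induced (U :\ v)) (f y) (f z).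
  have := fwalk w x (connected_in_connect cU Uw Ux).
  by rewrite /f (negPf wv) (negPf xv).
case/connectP=> p + ->; elim: p y => [|y' p IHp] y //= /andP[eyy' /IHp].
apply: connect_trans; rewrite /f.
case: (eqVneq y v) => [yv|yv]; case: (eqVneq y' v) => [y'v|y'v] //.
- by rewrite yv in eyy'; rewrite (only_w _ eyy').
- by rewrite [y]only_w // induced_sym -y'v.
by apply: connect1; move: eyy'; rewrite /induced !inE yv y'v.
Qed.

(** * Connected vertex sets of a forest *)

Hypothesis r_acyclic : acyclic r.

(** Otherwise a simple walk from [a] to [b] that avoids [v] closes up through
    [v] into a cycle. *)
Lemma neighbours_separated v a b :
  r v a -> r v b -> connect (induced [set~ v]) a b -> a = b.
Proof.
move=> rva rvb /connectP[p0 ep0 def_b]; apply/eqP; apply: contraT => ab.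
case/shortenP: ep0 def_b => p ep Up _ def_b.
have av : a != v by apply: contraTneq rva => ->; rewrite r_irrefl.
suff /(acyclicP _ r_acyclic) []: ucycle r (v :: a :: p).
  by case: p def_b {ep Up} => // eab; rewrite eab eqxx in ab.
apply/andP; split; last first.
  rewrite cons_uniq Up andbT inE negb_or eq_sym av.
  elim: p (a) ep {def_b Up} => //= y p IHp x /andP[/and3P[_ + _] /IHp].
  by rewrite !inE negb_or eq_sym => ->.
rewrite /= rva rcons_path -def_b r_sym rvb andbT.
by apply: sub_path ep => x y /and3P[].
Qed.

(** A common vertex [y] would give a way from [u] to [w] through [y] other
    than the edge itself; [w'], its last vertex before [w], and [u] would be
    two neighbours of [w] that are joined off [w]. *)
Lemma edge_separates A B u w :
    connected_in A -> connected_in B -> r u w ->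
  u \in A -> w \notin A -> u \notin B -> w \in B -> [disjoint A & B].
Proof.
move=> cA cB ruw Au wA uB Bw; apply/pred0Pn => -[y /andP[/= Ay By]].
have /connectP[p0 ep0 def_y] := connected_in_connect cB Bw By.
case/shortenP: ep0 def_y => -[|w' p] /=.
  by move=> _ _ _ yw; rewrite -yw Ay in wA.
case/andP=> /and3P[_ Bw' rww'] ep /and3P[+ _ _] _ def_y.
rewrite inE negb_or eq_sym => /andP[w'w wp].
suff eq_w'u : w' = u by rewrite -eq_w'u Bw' in uB.
apply: (@neighbours_separated w) => //; first by rewrite r_sym.
have sA : A \subset [set~ w] by rewrite -setCS setCK sub1set inE.
apply: connect_trans (connect_inducedS sA (connected_in_connect cA Ay Au)).
apply/connectP; exists p => //.
elim: p (w') w'w wp ep {def_y Bw' rww'} => //= z p IHp x xw.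
rewrite inE negb_or eq_sym => /andP[zw wp] /andP[/and3P[_ _ rxz] ep].
by rewrite IHp // /induced !inE xw zw rxz.
Qed.

(** A maximal proper connected subset of [V] that extends [U] misses a single
    vertex [w].  As [w] is not an end, it has two neighbours, which that subset
    joins off [w]. *)
Lemma connected_in_ends_full V U :
    connected_in V -> connected_in U ->
  U \subset V -> ends V \subset U -> U = V.
Proof.
move=> cV cU sUV sEU; apply/eqP; apply: contraT => neUV.
pose P := [pred X : {set T} | [&& connected_in X, U \subset X & X \proper V]].
have [|X /maxsetP[/and3P[cX sUX pXV] maxX] _] := @maxset_exists _ P U.
  by rewrite /= cU subxx properEneq neUV.
have [sXV [v Vv vX]] := properP pXV.
have [x Xx] : exists x, x \in X by apply/set0Pn; case/andP: cX.
have xv := connected_in_connect cV (subsetP sXV _ Xx) Vv.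
have [u [w [Xu wX /and3P[Vu Vw ruw]]]] := connect_crossing xv Xx vX.
have defV : w |: X = V.
  apply/eqP; apply: contraNT wX => neV.
  rewrite -[X](maxX (w |: X)) ?subsetUr ?setU11 //=.
  rewrite (connected_in_add cX Xu ruw) (subset_trans sUX) ?subsetUr //=.
  by rewrite properEneq neV subUset sub1set Vw.
case/negP: (wX); apply: (subsetP sUX); apply: (subsetP sEU).
rewrite inE Vw; apply/cards1P; exists u; apply/setP=> t; rewrite !inE.
apply/idP/eqP=> [/and3P[_ Vt rwt] | ->]; last by rewrite /induced Vw Vu r_sym.
have Xt : t \in X.
  by move: Vt; rewrite -defV => /setU1P[tw|//]; rewrite tw r_irrefl in rwt.
have sXw : X \subset [set~ w] by rewrite -setCS setCK sub1set inE.
apply: (@neighbours_separated w) => //; first by rewrite r_sym.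
by apply: connect_inducedS sXw _; apply: connected_in_connect.
Qed.

(** A connected set of least size between [D] and [V] will do: an end outside
    [D] could be deleted from it. *)
Lemma smallest_connected_in V D :
    connected_in V -> D \subset V ->
  exists S, [/\ S \subset V, D \subset S, connected_in S & ends S \subset D].
Proof.
move=> cV sDV.
pose P (S : {set T}) := [&& S \subset V, D \subset S & connected_in S].
have PV : P V by rewrite /P subxx sDV cV.
case: (arg_minnP (fun S : {set T} => #|S|) PV) => S /and3P[sSV sDS cS] minS.
exists S; split=> //; apply/subsetP=> x Ex; apply: contraT => xD.
have Sx : x \in S by move: Ex; rewrite inE => /andP[].
have /minS : P (S :\ x).
  rewrite /P (subset_trans (subD1set S x) sSV) subsetD1 sDS xD.
  exact: connected_in_del_pendant.
by rewrite [#|S|](cardsD1 x) Sx ltnn.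
Qed.

(** * Pruning one end of a tree *)

Section Prunings.

Variables (V : {set T}) (S : T -> {set T}).
Hypothesis cV : connected_in V.
Hypothesis V_gt2 : 2 < #|ends V|.
Hypothesis S_sub : {in ends V, forall x, S x \subset V}.
Hypothesis S_conn : {in ends V, forall x, connected_in (S x)}.
Hypothesis S_ends : {in ends V, forall x, ends V :\ x \subset S x}.

Lemma prunings_meet x z :
  x \in ends V -> z \in ends V -> exists2 y, y \in S x & y \in S z.
Proof.
move=> Ex Ez; have /subsetPn[y Ey] : ~~ (ends V \subset [set x; z]).
  apply: contraL V_gt2 => /subset_leq_card leE.
  by rewrite -leqNgt (leq_trans leE) // cards2; case: (x != z).
rewrite !inE negb_or => /andP[yx yz].
by exists y; [apply: (subsetP (S_ends Ex)) | apply: (subsetP (S_ends Ez))];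
  rewrite in_setD1 ?yx ?yz.
Qed.

Lemma prunings_cover x z :
  x \in ends V -> z \in ends V -> x != z -> S x :|: S z = V.
Proof.
move=> Ex Ez xz; have [y Sxy Szy] := prunings_meet Ex Ez.
apply: connected_in_ends_full => //.
- exact: connected_inU (S_conn Ex) (S_conn Ez) Sxy Szy.
- by rewrite subUset !S_sub.
apply/subsetP=> t Et; rewrite inE; case: (eqVneq t x) => [tx | tx].
  by rewrite orbC (subsetP (S_ends Ez)) // in_setD1 Et tx xz.
by rewrite (subsetP (S_ends Ex)) // in_setD1 Et tx.
Qed.

(** If each vertex were pruned with some end, an edge [u w] with [u] outside
    [S x] and [w] in [S x] but outside some [S z] would separate the meeting
    sets [S x] and [S z]. *)
Lemma prunings_common : exists2 v, v \in V & {in ends V, forall x, v \in S x}.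
Proof.
pose common v := [forall x in ends V, v \in S x].
case: (boolP [exists v in V, common v]) => [|no_common].
  by case/exists_inP=> v Vv /forall_inP; exists v.
have pruned v : v \in V -> exists2 x, x \in ends V & v \notin S x.
  move=> Vv; apply/exists_inP; rewrite -negb_forall_in.
  by apply: contra no_common => cv; apply/exists_inP; exists v.
have [u0 Vu0] : exists u0, u0 \in V by apply/set0Pn; case/andP: cV.
have [x Ex u0x] := pruned u0 Vu0.
have [y Sxy _] := prunings_meet Ex Ex.
have Vy := subsetP (S_sub Ex) y Sxy.
have [w [u [Sxw uSx /and3P[Vw Vu rwu]]]] :=
  connect_crossing (connected_in_connect cV Vy Vu0) Sxy u0x.
have [z Ez wz] := pruned w Vw.
have xz : x != z by apply: contraTneq Sxw => ->.
have Szu : u \in S z.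
  by move: Vu; rewrite -(prunings_cover Ex Ez xz) inE (negPf uSx).
have [t Sxt Szt] := prunings_meet Ex Ez.
have := edge_separates (S_conn Ex) (S_conn Ez) rwu Sxw uSx wz Szu.
by move/disjoint_setI0/setP/(_ t); rewrite !inE Sxt Szt.
Qed.

(** Count the pairs of an end [x] and a vertex [v] outside [S x] by [v]: a
    vertex is outside at most one [S x], and some vertex is outside none. *)
Lemma sum_prunings : \sum_(x in ends V) #|V :\: S x| < #|V|.
Proof.
have [v0 Vv0 v0S] := prunings_common.
have -> : \sum_(x in ends V) #|V :\: S x|
          = \sum_(v in V) \sum_(x in ends V) (v \notin S x).
  rewrite exchange_big; apply: eq_bigr => x _ /=.
  rewrite -sum1_card big_mkcond [RHS]big_mkcond; apply: eq_bigr => v _.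
  by rewrite inE; case: (v \in V); case: (v \in S x).
rewrite (bigD1 v0) //= big1 ?add0n => [|x Ex]; last by rewrite v0S.
rewrite (cardsD1 v0) Vv0 ltnS -sum1_card.
rewrite [X in _ <= X](eq_bigl (fun v => (v \in V) && (v != v0))); last first.
  by move=> v; rewrite in_setD1 andbC.
apply: leq_sum => v /andP[Vv _].
case: (pickP [pred x in ends V | v \notin S x]) => [x /andP[Ex vx] | none].
  rewrite (bigD1 x) //= vx big1 // => z /andP[Ez zx].
  apply/eqP; rewrite eqb0 negbK.
  by move: Vv; rewrite -(prunings_cover Ex Ez) 1?eq_sym // inE (negPf vx).
by rewrite big1 // => x Ex; move: (none x); rewrite /= Ex => /= ->.
Qed.

End Prunings.

(** The cheapest of the prunings loses at most the average, which is less than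
    [m]. *)
Lemma prune_end V m :
    connected_in V -> 2 < #|ends V| -> #|V| <= m * #|ends V| ->
  exists S, [/\ connected_in S, #|ends S| < #|ends V| & #|V| < m + #|S|].
Proof.
move=> cV V_gt2 leVm.
pose pruning x (S : {set T}) := [/\ S \subset V, ends V :\ x \subset S,
  connected_in S & ends S \subset ends V :\ x].
have /fin_all_exists[S prS] x : exists S, pruning x S.
  apply: smallest_connected_in => //; apply: subset_trans (subD1set _ _) _.
  by apply/subsetP=> t; rewrite inE => /andP[].
suff /exists_inP[x Ex ltVm] : [exists x in ends V, #|V| < m + #|S x|].
  exists (S x); have [_ _ cS sE] := prS x; split=> //.
  by rewrite [#|ends V|](cardsD1 x) Ex ltnS subset_leq_card.
apply: contraLR leVm; rewrite negb_exists_in -ltnNge => /forall_inP big_prunings.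
apply: leq_ltn_trans (@sum_prunings V S cV V_gt2 _ _ _) => [|x _|x _|x _];
  try by have [] := prS x.
rewrite mulnC -sum_nat_const; apply: leq_sum => x /big_prunings.
rewrite -leqNgt cardsD (setIidPr _) ?leq_subRL; first by rewrite addnC.
  by have [sSV _ _ _] := prS x; apply: subset_leq_card.
by have [] := prS x.
Qed.

End ConnectedSets.

(** * Trees in a graph *)

Section Subgraphs.

Variable G : sgraph.
Implicit Types (H : subgr G) (U : {set G}).

Definition restrict_to H U : subgr G := (U, [set A in H.2 | A \subset U]).

Lemma sub_adj_restrict H U :
  sub_adj (restrict_to H U) =2 induced (sub_adj H) U.
Proof.
by move=> x y; rewrite /sub_adj /induced inE subUset !sub1set andbC andbA.
Qed.

Lemma sub_adj_sym H : symmetric (sub_adj H).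
Proof. by move=> x y; rewrite /sub_adj setUC. Qed.

Lemma sub_adj_irrefl H : is_subgraph H -> irreflexive (sub_adj H).
Proof.
case/andP=> /subsetP sHG _ x; apply: contraTF isT => /sHG.
rewrite inE => /existsP[a /existsP[b /andP[ab /eqP xx]]].
have /set2P ax : a \in [set x; x] by rewrite xx set21.
have /set2P bx : b \in [set x; x] by rewrite xx set22.
by case: ax ab => ->; case: bx => ->; rewrite adj_irrefl.
Qed.

Lemma sub_adj_induced H : is_subgraph H -> sub_adj H =2 induced (sub_adj H) H.1.
Proof.
case/andP=> _ /forall_inP sH x y; rewrite /induced.
case: (boolP (sub_adj H x y)) => [exy|]; last by rewrite !andbF.
by have := sH _ exy; rewrite subUset !sub1set => /andP[-> ->].
Qed.

Lemma eq_connected_on (T : finType) (U : {set T}) (r1 r2 : rel T) :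
  r1 =2 r2 -> connected_on U r1 = connected_on U r2.
Proof.
move=> eqr; congr (_ && _); apply: eq_forallb => x; congr (_ ==> _).
by apply: eq_forallb => y; rewrite (eq_connect eqr).
Qed.

Lemma leaves_ends H (r : rel G) :
  sub_adj H =2 induced r H.1 -> leaves H = ends r H.1.
Proof.
move=> eqr; apply/setP=> x; rewrite !inE /sub_degree.
by congr (_ && (_ == _)); apply: eq_card => y; rewrite !inE eqr.
Qed.

Lemma restrict_tree H U :
  is_tree H -> connected_in (sub_adj H) U -> is_tree (restrict_to H U).
Proof.
case/and3P=> /andP[sHG _] _ acH cU; apply/and3P; split.
- apply/andP; split; last by apply/forall_inP => A; rewrite inE => /andP[].
  by apply: subset_trans sHG; apply/subsetP=> A; rewrite inE => /andP[].
- by rewrite (eq_connected_on _ (sub_adj_restrict H U)).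
apply/acyclicP => c c_gt2 /andP[cyc_c Uc]; apply: (acyclicP _ acH c c_gt2).
rewrite /ucycle Uc andbT; case: c cyc_c {c_gt2 Uc} => //= x c.
by apply: sub_path => y z; rewrite sub_adj_restrict => /and3P[].
Qed.

Lemma tk_attained k :
  0 < tk G k -> exists2 H : subgr G, ended_tree k H & tk G k = #|H.1|.
Proof.
case: (pickP (fun H : subgr G => ended_tree k H)) => [H0 tH0 _|none].
  have [|H tH eqk] := @eq_bigmax_cond _ (ended_tree k) (@sub_order G).
    by apply/card_gt0P; exists H0.
  by exists H.
by rewrite /tk big_pred0.
Qed.

Lemma leq_tk k (H : subgr G) : ended_tree k H -> #|H.1| <= tk G k.
Proof. exact: (@leq_bigmax_cond _ (ended_tree k) (@sub_order G)). Qed.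

(** Either the largest [k.+1]-ended tree is already [k]-ended, or it has at
    least three leaves and one of them can be pruned. *)
Lemma tk_prune k m :
    1 < k -> 0 < m -> tk G k.+1 <= m * k.+1 ->
  tk G k.+1 < m + tk G k.
Proof.
move=> k_gt1 m_gt0 le_tk.
case: (posnP (tk G k.+1)) => [->|/tk_attained[H /andP[tH le_kH] eq_tk]].
  by rewrite addn_gt0 m_gt0.
have [sH cH acH] := and3P tH.
case: (ltngtP #|leaves H| k.+1) le_kH => // [lt_kH|eq_kH] _.
  rewrite eq_tk -add1n leq_add // leq_tk // /ended_tree tH.
  by rewrite -ltnS.
have eqH := sub_adj_induced sH.
have eqE : leaves H = ends (sub_adj H) H.1 by apply: leaves_ends.
rewrite (eq_connected_on _ eqH) in cH.
have [||S [cS ltE ltS]] := @prune_end _ _ (@sub_adj_sym H)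
  (sub_adj_irrefl sH) acH H.1 m cH; rewrite -?eqE ?eq_kH -?eq_tk //.
rewrite -eqE eq_kH -eq_tk in ltE ltS.
apply: leq_trans ltS _; rewrite leq_add2l (@leq_tk _ (restrict_to H S)) //.
rewrite /ended_tree restrict_tree //=.
by rewrite (leaves_ends (sub_adj_restrict H S)).
Qed.

End Subgraphs.

Import Order.TTheory GRing.Theory Num.Theory.
Local Open Scope ring_scope.

Theorem theorem1 (G : sgraph) (k lam : nat) :
  connected_graph G -> (2 <= k)%N -> (0 < lam)%N ->
  ((tk G k.+1)%:R / (k.+1)%:R <= lam%:R :> rat) ->
  ((tk G k.+1)%:Z - lam%:Z + 1 <= (tk G k)%:Z).
Proof.
move=> _ k_gt1 lam_gt0.
rewrite ler_pdivrMr ?ltr0n // -natrM ler_nat => /(tk_prune k_gt1 lam_gt0).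
by rewrite addrAC lerBlDl -!PoszD lez_nat addn1.
Qed.
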